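(* Let $\lambda>0$, $\alpha,\beta>-1$, and let $n\ge 0$ be an integer. Then $$\int_{-1}^1\bigl(C_n^{(\lambda)}(x)\bigr)^2(1-x)^\alpha(1+x)^\beta\,dx = 2^{\alpha+\beta+1}\,\frac{\Gamma(\alpha+1)\Gamma(\beta+1)}{\Gamma(\alpha+\beta+2)}\left(\frac{(2\lambda)_n}{n!}\right)^2\;{}_5F_4\!\left(\begin{matrix}-n,\;n+2\lambda,\;\lambda,\;\alpha+1,\;\beta+1\\ 2\lambda,\;\lambda+\frac12,\;\frac{\alpha+\beta+2}{2},\;\frac{\alpha+\beta+3}{2}\end{matrix}\,\middle|\,1\right).$$
   Context: $C_n^{(\lambda)}$ denotes the Gegenbauer polynomial in the standard normalisation $\sum_{n=0}^\infty C_n^{(\lambda)}(x)z^n=(1-2xz+z^2)^{-\lambda}$. The Pochhammer symbol is $(a)_n=a(a+1)\cdots(a+n-1)$, $(a)_0=1$. The hypergeometric function is ${}_pF_q\!\left(\begin{smallmatrix}a_1,\ldots,a_p\\ b_1,\ldots,b_q\end{smallmatrix}\,\middle|\,z\right)=\sum_{k\ge0}\frac{(a_1)_k\cdots(a_p)_k}{(b_1)_k\cdots(b_q)_k\,k!}z^k$; here the series terminates because $-n$ is an upper parameter. *)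

(* Defs.v *)
From HB Require Import structures.
From mathcomp Require Import all_boot all_order all_algebra.
From mathcomp Require Import all_classical all_reals all_analysis.
Set Implicit Arguments.
Unset Strict Implicit.
Unset Printing Implicit Defensive.
Import Order.TTheory GRing.Theory Num.Theory.
Import numFieldNormedType.Exports.
Local Open Scope classical_set_scope.
Local Open Scope ring_scope.

Definition pochhammer (R : realType) (a : R) (k : nat) : R :=
  \prod_(i < k) (a + i%:R).

(* pFq(a_1, ..., a_p; b_1, ..., b_q | z), with p = size a and q = size b.
   Meaningful when no entry of b is 0 or a negative integer and the series
   converges, in particular when an entry of a is 0 or a negative integer. *)
Definition hypergeometric (R : realType) (a b : seq R) (z : R) : R :=
  limn (series (fun k : nat =>
    (\prod_(c <- a) pochhammer c k) /
    ((\prod_(d <- b) pochhammer d k) * (k`!)%:R) * z ^+ k)).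

(* Euler's integral, used for a > 0.  The domain is open at 0, where powR
   would take the value 0 `^ (a - 1) = (a == 1)%:R. *)
Definition Gamma (R : realType) (a : R) : R :=
  \int[@lebesgue_measure R]_(t in `]0, +oo[) (t `^ (a - 1) * expR (- t)).

(* The generating identity is read as an expansion at z = 0: it holds for every
   real x and all z in a neighbourhood of 0, which may depend on x.  It
   determines each polynomial C n. *)
Definition gegenbauer_generating (R : realType) (lambda : R)
    (C : nat -> {poly R}) : Prop :=
  forall x : R, \forall z \near (0 : R),
    series (fun n : nat => (C n).[x] * z ^+ n) @ \oo -->
      (1 - 2 * x * z + z ^+ 2) `^ (- lambda).

(* Such a family exists for every lambda, so the default 0 is not reached. *)
Definition gegenbauer (R : realType) (lambda : R) : nat -> {poly R} :=
  xget (fun=> 0) [set C | gegenbauer_generating lambda C].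

(* Main.v *)
Require Import Defs.
From HB Require Import structures.
From mathcomp Require Import all_boot all_order all_algebra.
From mathcomp Require Import all_classical all_reals all_analysis.
From mathcomp Require Import measurable_realfun.
From mathcomp Require Import ring lra.
Set Implicit Arguments.
Unset Strict Implicit.
Unset Printing Implicit Defensive.
Import Order.TTheory GRing.Theory Num.Theory.
Import numFieldNormedType.Exports.
Local Open Scope classical_set_scope.
Local Open Scope ring_scope.

(** Write l for lambda and y = 1 - x ^ 2.

    The square of C_n^(l) is a polynomial in y, and Clausen's identity gives
    its coefficients:
      C_n(x) ^ 2 = ((2 l)_n / n!) ^ 2 * 3F2(-n, n + 2 l, l; 2 l, l + 1/2; y).
    Since y = (1 - x) (1 + x), integrating the k-th term against the weight
    (1 - x) ^ alpha (1 + x) ^ beta only shifts both exponents by k, so that it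
    is a Beta integral, equal to the one for k = 0 times
      (alpha + 1)_k (beta + 1)_k
        / (((alpha + beta + 2) / 2)_k ((alpha + beta + 3) / 2)_k).
    These factors turn the 3F2 into the 5F4 of the theorem.

    Three facts carry the argument.

    - Identification of C_n.  The polynomials given by the three-term recurrence
      grow at most geometrically at each x, so their generating series F
      converges near 0; the recurrence says that
      (1 - 2 x z + z ^ 2) F' = 2 l (x - z) F, hence F (1 - 2 x z + z ^ 2) ^ l is
      constant and F is the generating function [gegenbauer_generating_rec].
      Coefficients of power series being unique, C_n is the polynomial of the
      recurrence [gegenbauerE].

    - Clausen's identity [gegenbauer_rec_sqr].  The recurrence yields the
      second-order differential equation of C_n [gegenbauer_rec_ode], hence a
      third-order one for C_n ^ 2 [sqr_ode].  In the variable y the latter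
      becomes a two-term recurrence on coefficients [coef_gegenbauer_rec_sqr],
      which is the recurrence of the 3F2; the constant term is C_n(1) ^ 2.

    - Euler's relation between Beta and Gamma [gamma_beta], obtained by Tonelli's
      theorem as an identity in the extended reals.  With b = 1 it also gives
      Gamma (a + 1) = a Gamma a, from which follow finiteness, positivity and
      the quotients of Gamma values that are needed. *)

(** * Gegenbauer polynomials by their three-term recurrence *)

Section Recurrence.
Context {F : numFieldType} (l : F).
Implicit Types n k : nat.

Fixpoint gegenbauer_rec n : {poly F} :=
  match n with
  | 0 => 1
  | 1 => (2 * l) *: 'X
  | (m.+1 as p).+1 => p.+1%:R^-1 *:
      ((2 * (p%:R + l)) *: ('X * gegenbauer_rec p)
       - (m%:R + 2 * l) *: gegenbauer_rec m)
  end.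

Local Notation G := gegenbauer_rec.
Local Notation L := (l%:P : {poly F}).

Lemma gegenbauer_recS n :
  n.+2%:R * G n.+2 = 2 * (n.+1%:R + L) * 'X * G n.+1 - (n%:R + 2 * L) * G n.
Proof.
have -> : G n.+2 = n.+2%:R^-1 *: ((2 * (n.+1%:R + l)) *: ('X * G n.+1)
    - (n%:R + 2 * l) *: G n) by [].
rewrite -[n.+2%:R in LHS]polyC_natr mul_polyC scalerA divff ?pnatr_eq0//.
rewrite scale1r -!mul_polyC !(polyC_natr, polyCM, polyCD); ring.
Qed.

Lemma natr_poly_neq0 n : n.+1%:R != 0 :> {poly F}.
Proof. by rewrite -polyC_natr polyC_eq0 pnatr_eq0. Qed.

(** Each of the two classical relations is needed in the induction step of the
    other, which is why they are proved together. *)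
Lemma deriv_gegenbauer_rec n :
  n.+1%:R * G n.+1 = 'X * (G n.+1)^`() - (G n)^`() /\
  (G n.+1)^`() = 'X * (G n)^`() + (n%:R + 2 * L) * G n.
Proof.
elim: n => [|n []].
  by rewrite /= -!mul_polyC !poly.derivE !(polyC_natr, polyCM); split; ring.
move: (gegenbauer_recS n).
move: (G n.+2) (G n.+1) (G n) => r q p rec IH1 IH2.
have dr : n.+2%:R * r^`() =
    2 * (n.+1%:R + L) * (q + 'X * q^`()) - (n%:R + 2 * L) * p^`().
  have := congr1 (fun p => p^`()) rec.
  rewrite -!polyC_natr -!(polyCM, polyCD) !poly.derivE.
  rewrite !(polyC_natr, polyCM, polyCD) => e.
  transitivity (0 * r + n.+2%:R * r^`()); first by ring.
  rewrite e; ring.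
have dp : p^`() = 'X * q^`() - n.+1%:R * q by rewrite IH1; ring.
have dr' : r^`() = 'X * q^`() + (n.+1%:R + 2 * L) * q.
  apply: (mulfI (natr_poly_neq0 n.+1)); rewrite dr dp; ring.
split=> //; rewrite rec dr'.
have -> : (n%:R + 2 * L) * p = q^`() - 'X * p^`() by rewrite IH2; ring.
by rewrite dp; ring.
Qed.

(** Differentiating the first-order relation
    (1 - X^2) G_n' = (n + 2 l) X G_n - (n + 1) G_(n+1)
    and eliminating G_(n+1)' by [deriv_gegenbauer_rec]. *)
Lemma gegenbauer_rec_ode n :
  (1 - 'X ^+ 2) * (G n)^`()^`() =
  (2 * l + 1)%:P * 'X * (G n)^`() - (n%:R * (n%:R + 2 * l))%:P * G n.
Proof.
rewrite !(polyC_natr, polyCM, polyCD).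
have [] := deriv_gegenbauer_rec n.
move: (G n.+1) (G n) => q p h1 h2.
have e : (1 - 'X ^+ 2) * p^`() = (n%:R + 2 * L) * 'X * p - n.+1%:R * q.
  by rewrite h1 h2; ring.
have := congr1 (fun p => p^`()) e.
rewrite -!polyC_natr -!(polyCM, polyCD) !poly.derivE.
rewrite !(polyC_natr, polyCM, polyCD) h2 => e2.
transitivity ((0 - 'X *+ 2) * p^`() + (1 - 'X ^+ 2) * p^`()^`()
  + 2 * 'X * p^`()); first by ring.
by rewrite e2; ring.
Qed.

Lemma horner1_gegenbauer_rec n :
  (G n).[1] = (\prod_(i < n) (2 * l + i%:R)) / n`!%:R.
Proof.
suff [] : (G n).[1] = (\prod_(i < n) (2 * l + i%:R)) / n`!%:R /\
  (G n.+1).[1] = (\prod_(i < n.+1) (2 * l + i%:R)) / n.+1`!%:R by [].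
elim: n => [|n [IH1 IH2]].
  by rewrite big_ord0 big_ord1 /= !hornerE fact0 factS fact0 muln1 mulr1n invr1 mulr1.
split=> //.
move: IH1 IH2 (gegenbauer_recS n).
move: (G n.+2) (G n.+1) (G n) => r q p IH1 IH2 /(congr1 (fun p => p.[1])).
rewrite -!polyC_natr !hornerE IH1 IH2 => e.
apply: (mulfI (_ : n.+2%:R != 0)); first by rewrite pnatr_eq0.
rewrite e !big_ord_recr/= !factS !natrM.
have : (n`!%:R : F) != 0 by rewrite pnatr_eq0 -lt0n fact_gt0.
have : n.+1%:R != 0 :> F by rewrite pnatr_eq0.
have : n.+2%:R != 0 :> F by rewrite pnatr_eq0.
have -> : n.+2%:R = n%:R + 2 :> F by rewrite -!natr1; ring.
have -> : n.+1%:R = n%:R + 1 :> F by rewrite -natr1.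
move=> h2 h1 h0; field.
by rewrite h2 h1 h0.
Qed.

(** The recurrence alternates parity, and an even polynomial is a polynomial in
    1 - X^2. *)
Lemma gegenbauer_rec_parity n :
  exists P, G n = 'X ^+ odd n * (P \Po (1 - 'X ^+ 2)).
Proof.
suff [] : (exists P, G n = 'X ^+ odd n * (P \Po (1 - 'X ^+ 2))) /\
  (exists P, G n.+1 = 'X ^+ odd n.+1 * (P \Po (1 - 'X ^+ 2))) by [].
elim: n => [|n [[P hP] [Q hQ]]].
  split; first by exists 1; rewrite /= comp_polyC mulr1.
  by exists (2 * l)%:P; rewrite /= comp_polyC -mul_polyC mulrC.
split; first by exists Q.
exists (n.+2%:R^-1 *: ((2 * (n.+1%:R + l)) *: ((if odd n then 1 else 1 - 'X) * Q)
    - (n%:R + 2 * l) *: P)).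
have -> : G n.+2 = n.+2%:R^-1 *: ((2 * (n.+1%:R + l)) *: ('X * G n.+1)
    - (n%:R + 2 * l) *: G n) by [].
rewrite hP hQ comp_polyZ comp_polyB !comp_polyZ comp_polyM /= negbK -!mul_polyC.
case: (odd n) => /=.
  by rewrite expr0 expr1 comp_polyC; ring.
by rewrite expr0 expr1 comp_polyB comp_polyX comp_polyC; ring.
Qed.

Lemma gegenbauer_rec_sqr_even n :
  exists Q, G n ^+ 2 = Q \Po (1 - 'X ^+ 2).
Proof.
have [P ->] := gegenbauer_rec_parity n.
exists ((if odd n then 1 - 'X else 1) * P ^+ 2).
rewrite exprMn comp_polyM (rmorphXn (comp_poly _)) /=.
case: (odd n) => /=; last by rewrite expr0 comp_polyC; ring.
by rewrite expr1 comp_polyB comp_polyX comp_polyC; ring.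
Qed.

End Recurrence.

(** * The differential equation of the square, in the variable 1 - X^2 *)

Section SquareEquation.
Context {F : numFieldType}.
Implicit Types (m N : F) (p Q H u : {poly F}).

(** For a solution p of (1 - X^2) p'' = m X p' - N p, this operator sends p ^ 2
    to 2 (1 - X^2) p' ^ 2. *)
Definition square_op m N u :=
  (1 - 'X ^+ 2) * u^`()^`() - m%:P * 'X * u^`() + 2 * N%:P * u.

(** [square_op] in the variable y = 1 - X^2, where it reads
    4 y (1 - y) Q'' + (2 m - (2 m + 2) y) Q' + 2 N Q.  In the form below the
    k-th coefficient comes from two rules only, those for p' and for X p'. *)
Definition square_opY m N Q :=
  4 * 'X * Q^`()^`() - 4 * ('X * ('X * Q^`())^`() - 'X * Q^`())
  + 2 * m%:P * Q^`() - (2 * m%:P + 2) * ('X * Q^`()) + 2 * N%:P * Q.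

(** Differentiate 2 (1 - X^2) p' ^ 2 and replace (1 - X^2) p'' by its value:
    only p' ^ 2 and p p' remain, and these are [square_op] and the derivative of
    p ^ 2 up to factors. *)
Lemma sqr_ode m N p :
  (1 - 'X ^+ 2) * p^`()^`() = m%:P * 'X * p^`() - N%:P * p ->
  (1 - 'X ^+ 2) * (square_op m N (p ^+ 2))^`() =
  2 * (m%:P - 1) * 'X * square_op m N (p ^+ 2)
  - 2 * N%:P * (1 - 'X ^+ 2) * (p ^+ 2)^`().
Proof.
move=> ode.
have du : (p ^+ 2)^`() = 2 * p * p^`() by rewrite expr2 !poly.derivE; ring.
have gE : square_op m N (p ^+ 2) = 2 * (1 - 'X ^+ 2) * p^`() ^+ 2.
  have ddu : (p ^+ 2)^`()^`() = 2 * p^`() ^+ 2 + 2 * p * p^`()^`().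
    by rewrite du -[2]polyC_natr !poly.derivE !polyC_natr; ring.
  rewrite /square_op ddu du.
  transitivity (2 * (1 - 'X ^+ 2) * p^`() ^+ 2
    + 2 * p * ((1 - 'X ^+ 2) * p^`()^`())
    - m%:P * 'X * (2 * p * p^`()) + 2 * N%:P * p ^+ 2); first by ring.
  by rewrite ode; ring.
have dg : (square_op m N (p ^+ 2))^`() =
    - 4 * 'X * p^`() ^+ 2 + 4 * p^`() * ((1 - 'X ^+ 2) * p^`()^`()).
  by rewrite gE [p^`() ^+ 2]expr2 -[2]polyC_natr !poly.derivE !polyC_natr; ring.
by rewrite dg ode gE du; ring.
Qed.

Lemma square_op_comp m N Q : square_op m N (Q \Po (1 - 'X ^+ 2)) =
  square_opY m N Q \Po (1 - 'X ^+ 2).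
Proof.
have dw : (1 - 'X ^+ 2 : {poly F})^`() = - 2 * 'X by rewrite !poly.derivE; ring.
have du : (Q \Po (1 - 'X ^+ 2))^`() = - 2 * 'X * (Q^`() \Po (1 - 'X ^+ 2)).
  by rewrite deriv_comp dw; ring.
have d2X : (- 2 * 'X : {poly F})^`() = -2.
  by rewrite mulNr derivN -[2]polyC_natr !poly.derivE; ring.
have ddu : (Q \Po (1 - 'X ^+ 2))^`()^`() = - 2 * (Q^`() \Po (1 - 'X ^+ 2))
    + 4 * 'X ^+ 2 * (Q^`()^`() \Po (1 - 'X ^+ 2)).
  by rewrite du derivM deriv_comp dw d2X; ring.
have -> : square_opY m N Q = 4 * 'X * (1 - 'X) * Q^`()^`()
    + (2 * m%:P - (2 * m%:P + 2) * 'X) * Q^`() + 2 * N%:P * Q.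
  by rewrite /square_opY derivM derivX; ring.
rewrite /square_op ddu du -!polyC_natr.
rewrite !(comp_polyC, comp_polyB, comp_polyD, comp_polyM, comp_polyX).
by rewrite !polyC_natr; ring.
Qed.

(** Both sides of the equation of [sqr_ode] are X times a polynomial in
    1 - X^2; composition with 1 - X^2 being injective, the factor X and the
    composition can be removed. *)
Lemma comp_ode m N Q :
  let u := Q \Po (1 - 'X ^+ 2) in
  (1 - 'X ^+ 2) * (square_op m N u)^`() =
  2 * (m%:P - 1) * 'X * square_op m N u - 2 * N%:P * (1 - 'X ^+ 2) * u^`() ->
  'X * (square_opY m N Q)^`() + (m%:P - 1) * square_opY m N Q
  + 2 * N%:P * ('X * Q^`()) = 0.
Proof.
move=> u; rewrite square_op_comp {}/u; move: (square_opY m N Q) => H.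
have dw : (1 - 'X ^+ 2 : {poly F})^`() = - 2 * 'X by rewrite !poly.derivE; ring.
rewrite !deriv_comp dw => ode.
set E := (X in X = 0).
have : 2 * 'X * (E \Po (1 - 'X ^+ 2)) = 0.
  rewrite /E -!polyC_natr.
  rewrite !(comp_polyC, comp_polyB, comp_polyD, comp_polyM, comp_polyX).
  rewrite !polyC_natr.
  transitivity (- ((1 - 'X ^+ 2) * ((H^`() \Po (1 - 'X ^+ 2)) * (-2 * 'X)))
    + 2 * (m%:P - 1) * 'X * (H \Po (1 - 'X ^+ 2))
    + 4 * N%:P * (1 - 'X ^+ 2) * 'X * (Q^`() \Po (1 - 'X ^+ 2))); first by ring.
  by rewrite ode; ring.
move/eqP; rewrite !mulf_eq0 polyX_eq0 orbF (negbTE (natr_poly_neq0 1)) /=.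
rewrite comp_poly_eq0 => [/eqP//|].
by rewrite -opprB size_polyN size_XnsubC.
Qed.

Lemma coefXderiv (p : {poly F}) k : ('X * p^`())`_k = k%:R * p`_k.
Proof. by rewrite coefXM; case: k => [|k]; rewrite ?mul0r// coef_deriv mulr_natl. Qed.

Lemma coef_deriv_mul (p : {poly F}) k : p^`()`_k = k.+1%:R * p`_k.+1.
Proof. by rewrite coef_deriv mulr_natl. Qed.

(** The two-term recurrence of the hypergeometric coefficients of Clausen's
    identity: extract the coefficient of y^k in [comp_ode]. *)
Lemma coef_gegenbauer_rec_sqr (l : F) n Q k :
  gegenbauer_rec l n ^+ 2 = Q \Po (1 - 'X ^+ 2) ->
  (k%:R + 2 * l) * (k%:R + l + 1 / 2) * k.+1%:R * Q`_k.+1 =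
  (k%:R - n%:R) * (k%:R + n%:R + 2 * l) * (k%:R + l) * Q`_k.
Proof.
move=> GQ; have := sqr_ode (gegenbauer_rec_ode l n).
rewrite GQ => /comp_ode.
set m := 2 * l + 1; set N := n%:R * _ => e.
have Hk : (square_opY m N Q)`_k = k.+1%:R * (4 * k%:R + 2 * m) * Q`_k.+1
    - (4 * k%:R * (k%:R - 1) + (2 * m + 2) * k%:R - 2 * N) * Q`_k.
  rewrite /square_opY -!polyC_natr -!(polyCM, polyCD) -!mulrA.
  by rewrite !(coefB, coefD, coefCM, coefXderiv, coef_deriv_mul); ring.
move: (square_opY m N Q) Hk e => H Hk.
move=> /(congr1 (fun p : {poly F} => p`_k)).
have -> : m%:P - 1 = (2 * l)%:P by rewrite -[1]/(1%:P) -polyCB /m addrK.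
rewrite -!polyC_natr -!polyCM !(coefD, coefCM, coefXderiv, coef0) Hk => e.
apply: (mulfI (_ : 4 != 0)); first by rewrite pnatr_eq0.
(* the terms of the equation that do not appear on the left-hand side *)
apply: (@addIr _ (2 * N * (k%:R * Q`_k) - (k%:R + 2 * l)
  * (4 * k%:R * (k%:R - 1) + (2 * m + 2) * k%:R - 2 * N) * Q`_k)).
set s := (X in X = 0) in e.
transitivity s; first by rewrite /s /m; field.
by rewrite e /m /N; ring.
Qed.

End SquareEquation.

(** * Clausen's identity *)

Section Clausen.
Context {R : realType}.
Implicit Types (a l : R) (n k : nat).

Lemma pochhammerS a k : pochhammer a k.+1 = pochhammer a k * (a + k%:R).
Proof. by rewrite /pochhammer big_ord_recr. Qed.

Lemma pochhammer_gt0 a k : 0 < a -> 0 < pochhammer a k.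
Proof. by move=> a0; apply: prodr_gt0 => i _; rewrite ltr_wpDr. Qed.

Lemma pochhammer_opp_nat n k : (n < k)%N -> pochhammer (- n%:R : R) k = 0.
Proof.
move=> nk; rewrite /pochhammer (bigD1 (Ordinal nk))//= addNr mul0r//.
Qed.

Definition clausen_coef l n k : R :=
  pochhammer (- n%:R) k * pochhammer (n%:R + 2 * l) k * pochhammer l k /
  (pochhammer (2 * l) k * pochhammer (l + 1 / 2) k * k`!%:R).

(** The coefficients of the square as a polynomial in y and those of the 3F2
    satisfy the same recurrence; the constant term is the value at y = 0, that
    is at x = 1. *)
Lemma gegenbauer_rec_sqr l n : 0 < l ->
  gegenbauer_rec l n ^+ 2 = \sum_(k < n.+1)
    ((pochhammer (2 * l) n / n`!%:R) ^+ 2 * clausen_coef l n k) *: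
      (1 - 'X ^+ 2) ^+ k.
Proof.
move=> l0; have [Q GQ] := gegenbauer_rec_sqr_even l n.
have Q0 : Q`_0 = (pochhammer (2 * l) n / n`!%:R) ^+ 2.
  have := congr1 (fun p : {poly R} => p.[1]) GQ.
  rewrite horner_comp !hornerE horner1_gegenbauer_rec => ->.
  by rewrite expr1n subrr horner_coef0.
have QE k : Q`_k = Q`_0 * clausen_coef l n k.
  elim: k => [|k IH].
    by rewrite /clausen_coef /pochhammer !big_ord0 fact0 !mulr1 divr1 mulr1.
  have := coef_gegenbauer_rec_sqr k GQ.
  rewrite IH /clausen_coef !pochhammerS factS natrM.
  have : 0 < k.+1%:R :> R by [].
  have : 0 < k`!%:R :> R by rewrite ltr0n fact_gt0.
  have : 0 < k%:R + 2 * l by rewrite ltr_wpDl// mulr_gt0.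
  have : 0 < k%:R + l + 1 / 2 by rewrite -addrA ltr_wpDl// addr_gt0.
  have : 0 < pochhammer (2 * l) k by rewrite pochhammer_gt0// mulr_gt0.
  have : 0 < pochhammer (l + 1 / 2) k by rewrite pochhammer_gt0// addr_gt0.
  move: (pochhammer _ _) (pochhammer _ _) => p q p0 q0 c1 c2 f0 k0 e.
  have := lt0r_neq0 c1; have := lt0r_neq0 c2; have := lt0r_neq0 k0.
  move=> k0' c2' c1'.
  have c0 := mulf_neq0 (mulf_neq0 c2' c1') k0'.
  apply: (mulfI c0); rewrite /= e; field.
  by rewrite !lt0r_neq0 //=; nra.
(* the factor (-n)_k makes the coefficients of degree above n vanish *)
have -> : gegenbauer_rec l n ^+ 2 = (\poly_(k < n.+1) Q`_k) \Po (1 - 'X ^+ 2).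
  rewrite GQ; congr (_ \Po _); apply/polyP => k; rewrite coef_poly.
  case: ltnP => // nk.
  by rewrite QE /clausen_coef pochhammer_opp_nat// !mul0r mulr0.
rewrite poly_def raddf_sum /=; apply: eq_bigr => k _.
by rewrite comp_polyZ comp_Xn_poly QE Q0.
Qed.
End Clausen.

(** * Power series with geometrically bounded coefficients *)

Section PowerSeries.
Context {R : realType}.
Implicit Types (c : R^nat) (B M z : R).

Definition geometric_bound c B M := forall n, `|c n| <= B * M ^+ n.

Lemma geometric_bound_diffs c B M : 0 <= B -> 0 <= M ->
  geometric_bound c B M -> geometric_bound (pseries_diffs c) (B * M) (2 * M).
Proof.
move=> B0 M0 cB n; rewrite /pseries_diffs normrM ger0_norm// exprMn.
rewrite (_ : B * M * _ = 2 ^+ n * (B * M ^+ n.+1)); last by rewrite exprS; ring.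
by rewrite ler_pM// -natrX ler_nat; exact: ltn_expl.
Qed.

Lemma cvg_pseries c B M z : 0 <= M -> geometric_bound c B M -> `|z| * M < 1 ->
  cvgn (pseries c z).
Proof.
move=> M0 cB zM; apply: normed_cvg.
have B0 : 0 <= B by have := le_trans (normr_ge0 _) (cB 0%N); rewrite expr0 mulr1.
apply: (@series_le_cvg _ _ (geometric B (`|z| * M))) => [n|n|n|] /=.
- exact: normr_ge0.
- by rewrite mulr_ge0// exprn_ge0// mulr_ge0.
- rewrite normrM normrX exprMn [leLHS]mulrC [leRHS]mulrCA.
  by rewrite ler_wpM2l ?exprn_ge0//; exact: cB.
- by apply: is_cvg_geometric_series; rewrite ger0_norm// mulr_ge0.
Qed.

(** Term-by-term differentiation at z asks for convergence of the series and of
    its first two derived series at a point beyond z.  Each derivation doubles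
    the ratio M, so that at 1 / (8 M) even the second derived series is dominated
    by a geometric series of ratio 1/2. *)
Lemma is_derive_pseries c B M z : 0 < M -> geometric_bound c B M ->
  `|z| * (8 * M) < 1 ->
  is_derive z (1 : R) (fun z => limn (pseries c z))
    (limn (pseries (pseries_diffs c) z)).
Proof.
move=> M0 cB zM.
have B0 : 0 <= B by have := le_trans (normr_ge0 _) (cB 0%N); rewrite expr0 mulr1.
have M0' := ltW M0.
have b1 := geometric_bound_diffs B0 M0' cB.
have b2 := geometric_bound_diffs (mulr_ge0 B0 M0') (mulr_ge0 (ler0n _ 2) M0') b1.
have K0 : 0 < (8 * M)^-1 by rewrite invr_gt0 mulr_gt0.
have KM : (8 * M)^-1 * M = 8^-1 by rewrite invfM -mulrA mulVf ?mulr1// lt0r_neq0.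
apply: (@pseries_snd_diffs _ _ (8 * M)^-1); rewrite ?(gtr0_norm K0)//.
- apply: cvg_pseries cB _ => //; rewrite gtr0_norm// KM; lra.
- apply: cvg_pseries b1 _; first lra.
  by rewrite gtr0_norm// mulrCA KM; lra.
- apply: cvg_pseries b2 _; first lra.
  by rewrite gtr0_norm// !(mulrCA (8 * M)^-1 2) KM; lra.
- by rewrite -[ltRHS]mul1r ltr_pdivlMr ?mulr_gt0.
Qed.

(** Cauchy's estimate: the terms c_n r^n are bounded if the series converges
    at r. *)
Lemma near0_geometric_bound c :
  (\forall z \near (0 : R), cvgn (pseries c z)) ->
  exists B M, [/\ 0 <= B, 0 < M & geometric_bound c B M].
Proof.
move=> /nbhs_ballP[r /= r0 cr].
have k0 : 0 < r / 2 by rewrite divr_gt0.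
have /cr/cvg_series_bounded[K [Kreal Kf]] : ball (0 : R) r (r / 2).
  by rewrite /ball/= sub0r normrN gtr0_norm//; lra.
exists (`|K| + 1), (r / 2)^-1; split; [by rewrite addr_ge0| by rewrite invr_gt0|].
move=> n; rewrite exprVn ler_pdivlMr ?exprn_gt0//.
rewrite -[X in _ * X](ger0_norm (exprn_ge0 _ (ltW k0))) -normrM.
by apply: Kf => //; rewrite (le_lt_trans (ler_norm K))// ltrDl.
Qed.

Lemma pseries_at0 c : limn (pseries c 0) = c 0%N.
Proof.
apply/cvg_lim => //; rewrite -(cvg_shiftS (pseries c 0)).
rewrite (_ : [sequence _]_n = fun=> c 0%N); first exact: cvg_cst.
apply/funext => n; rewrite /pseries /series /= big_nat_recl// expr0 mulr1.
by rewrite big1 ?addr0// => i _; rewrite expr0n mulr0.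
Qed.

(** The sum is the zero function near 0, and so are all its derivatives: the
    induction replaces c by the coefficients of the derivative. *)
Lemma pseries_eq0 c :
  (\forall z \near (0 : R), pseries c z @ \oo --> (0 : R)) -> forall n, c n = 0.
Proof.
move=> + n; elim: n c => [|n IH] c h0.
  have /cvg_lim := nbhs_singleton h0; rewrite -pseries_at0; exact.
have /near0_geometric_bound[B [M [B0 M0 cB]]] : \forall z \near (0 : R), cvgn (pseries c z).
  by apply: filterS h0 => z; exact: cvgP.
suff : pseries_diffs c n = 0.
  by move/eqP; rewrite mulf_eq0 pnatr_eq0 => /eqP.
apply: IH.
have small : \forall z \near (0 : R), `|z| * (8 * M) < 1.
  have e0 : 0 < (8 * M)^-1 by rewrite invr_gt0 mulr_gt0.
  apply/nbhs_ballP; exists (8 * M)^-1 => //= z; rewrite /ball/= sub0r normrN.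
  by rewrite -ltr_pdivlMr ?mulr_gt0// div1r.
have h1 : \forall z \near (0 : R), \forall y \near z,
    pseries c y @ \oo --> (0 : R) by exact: nbhs_interior.
near=> z.
have zM : `|z| * (8 * M) < 1 by near: z.
have dB := geometric_bound_diffs B0 (ltW M0) cB.
have cvg : cvgn (pseries (pseries_diffs c) z).
  apply: cvg_pseries dB _; first lra.
  by rewrite (le_lt_trans _ zM)// ler_wpM2l//; lra.
suff <- : limn (pseries (pseries_diffs c) z) = 0 by [].
have h := is_derive_pseries M0 cB zM.
have zero : \forall y \near z, cst 0 y = limn (pseries c y).
  have : \forall y \near z, pseries c y @ \oo --> (0 : R) by near: z.
  by apply: filterS => y /cvg_lim ->.
have h2 := near_eq_is_derive zero (is_derive_cst (0 : R) z 1).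
by have [_ <-] := h; have [_ <-] := h2.
Unshelve. all: by end_near. Qed.
End PowerSeries.

(** * The generating function *)

Lemma poly_funext0 {R : numDomainType} (p : {poly R}) :
  (forall x, p.[x] = 0) -> p = 0.
Proof.
move=> p0; apply: (@roots_geq_poly_eq0 _ _ [seq i%:R | i <- iota 0 (size p)]).
- by apply/allP => x _; apply/rootP.
- by rewrite map_inj_uniq ?iota_uniq// => i j /eqP; rewrite eqr_nat => /eqP.
- by rewrite size_map size_iota.
Qed.

Section Generating.
Context {R : realType} (l : R) (l0 : 0 < l).
Local Notation G := (gegenbauer_rec l).

Lemma horner_gegenbauer_recS n x : n.+2%:R * (G n.+2).[x] =
  2 * (n.+1%:R + l) * x * (G n.+1).[x] - (n%:R + 2 * l) * (G n).[x].
Proof.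
move: (gegenbauer_recS l n); move: (G n.+2) (G n.+1) (G n) => r q p.
by move=> /(congr1 (fun p => p.[x])); rewrite -!polyC_natr !hornerE.
Qed.

(** A ratio M with 2 (1 + l) |x| M + (1 + 2 l) <= M ^ 2.  As
    (n + 1 + l) / (n + 2) <= 1 + l and (n + 2 l) / (n + 2) <= 1 + 2 l, the
    recurrence then preserves the bound M ^ n. *)
Definition growth (x : R) : R := 2 * (1 + l) * `|x| + 1 + 2 * l.

Lemma growth_ge1 x : 1 <= growth x.
Proof. by rewrite /growth; have := normr_ge0 x; have := l0; nra. Qed.

Lemma gegenbauer_rec_bound x :
  geometric_bound (fun n => (G n).[x]) 1 (growth x).
Proof.
set M := growth x; have M1 : 1 <= M := growth_ge1 x.
suff h n : `|(G n).[x]| <= M ^+ n /\ `|(G n.+1).[x]| <= M ^+ n.+1.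
  by move=> n; rewrite mul1r; exact: (h n).1.
elim: n => [|n [IH1 IH2]].
  rewrite /= !hornerE expr0 expr1 normr1 lexx; split=> //.
  rewrite !normrM (gtr0_norm l0) ger0_norm// /M /growth.
  by have := normr_ge0 x; have := l0; nra.
split=> //; have := horner_gegenbauer_recS n x.
move: IH1 IH2; move: (G n.+2).[x] (G n.+1).[x] (G n).[x] => r q p hp hq e.
have n2 : 0 < n.+2%:R :> R by [].
rewrite -(ler_pM2l n2) -{1}(gtr0_norm n2) -normrM e.
apply: (le_trans (ler_normB _ _)).
rewrite !normrM (ger0_norm (_ : 0 <= 2))//.
have nn : 0 <= n%:R :> R by []; have ll := l0; have xx := normr_ge0 x.
have MM : 0 <= M ^+ n.+1 by rewrite exprn_ge0//; lra.
rewrite -(natr1 n.+1) -(natr1 n).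
rewrite (ger0_norm (_ : 0 <= n%:R + 1 + l)); last lra.
rewrite (ger0_norm (_ : 0 <= n%:R + 2 * l)); last lra.
have hp' : `|p| <= M ^+ n.+1 by rewrite (le_trans hp)// ler_weXn2l.
have {hp hp'} h : (n%:R + 2 * l) * `|p| <=
    ((n%:R + 1 + 1) * (1 + 2 * l)) * M ^+ n.+1.
  by rewrite ler_pM//; nra.
have {hq} h' : 2 * (n%:R + 1 + l) * `|x| * `|q| <=
    ((n%:R + 1 + 1) * (2 * (1 + l) * `|x|)) * M ^+ n.+1.
  rewrite ler_pM//; first by rewrite mulr_ge0//; lra.
  by rewrite mulrA ler_wpM2r//; nra.
apply: (le_trans (lerD h' h)).
rewrite [M ^+ n.+2]exprS; move: (M ^+ n.+1) => Y.
rewrite le_eqVlt; apply/orP; left; apply/eqP; rewrite /M /growth; ring.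
Qed.

(** The partial sums satisfy the equation up to a remainder of order z^n, given
    in closed form by the recurrence, which tends to 0. *)
Lemma generating_ode x z :
  let c n := (G n).[x] in
  cvgn (pseries c z) -> cvgn (pseries (pseries_diffs c) z) ->
  (1 - 2 * x * z + z ^+ 2) * limn (pseries (pseries_diffs c) z) =
  2 * l * (x - z) * limn (pseries c z).
Proof.
move=> c Cc Cd; set d := pseries_diffs c.
pose E n := (1 - 2 * x * z + z ^+ 2) * pseries d z n
  - 2 * l * (x - z) * pseries c z n.
have EE n : E n = 2 * l * x * (c n * z ^+ n) - d n * z ^+ n
    + z * (n%:R * (c n * z ^+ n)).
  elim: n => [|n IH].
    rewrite /E /pseries /series /= !big_geq// /d /pseries_diffs.
    by rewrite [c 0%N]hornerC [c 1%N]hornerZ hornerX; ring.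
  have -> : E n.+1 = E n + ((1 - 2 * x * z + z ^+ 2) * (d n * z ^+ n)
      - 2 * l * (x - z) * (c n * z ^+ n)).
    by rewrite /E /pseries /series /= !big_nat_recr//=; ring.
  rewrite IH.
  have dS : d n.+1 = 2 * (n.+1%:R + l) * x * c n.+1 - (n%:R + 2 * l) * c n.
    exact: horner_gegenbauer_recS.
  rewrite dS /d /pseries_diffs !exprS; ring.
have c0 : c n * z ^+ n @[n --> \oo] --> (0 : R) by exact: cvg_series_cvg_0 Cc.
have d0 : d n * z ^+ n @[n --> \oo] --> (0 : R) by exact: cvg_series_cvg_0 Cd.
have nc0 : n%:R * (c n * z ^+ n) @[n --> \oo] --> (0 : R).
  rewrite -(cvg_shiftS (fun n => n%:R * (c n * z ^+ n))).
  rewrite [X in X @ _ --> _](_ : _ = fun n => z * (d n * z ^+ n)).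
    have := cvgMl_tmp (a := z) d0; rewrite mulr0; exact.
  by apply/funext => n /=; rewrite /d /pseries_diffs exprS; ring.
have E0 : E n @[n --> \oo] --> (0 : R).
  rewrite (_ : E = fun n => 2 * l * x * (c n * z ^+ n) - d n * z ^+ n
    + z * (n%:R * (c n * z ^+ n))); last exact/funext.
  have -> : 0 = 2 * l * x * 0 - 0 + z * 0 :> R by ring.
  by apply: cvgD; [apply: cvgB => //; exact: cvgMl_tmp | exact: cvgMl_tmp].
apply/eqP; rewrite -subr_eq0; apply/eqP.
apply: (cvg_unique _ _ E0) => //.
by apply: cvgB; apply: cvgMl_tmp.
Qed.

(** The quotient of the series by the expected value has zero derivative by
    [generating_ode], and is 1 at z = 0. *)
Lemma gegenbauer_generating_rec : gegenbauer_generating l G.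
Proof.
move=> x; set c := fun n => (G n).[x].
have M1 := growth_ge1 x; set M := growth x in M1.
have M0 : 0 < M by lra.
have cB : geometric_bound c 1 M := gegenbauer_rec_bound x.
have dB := geometric_bound_diffs ler01 (ltW M0) cB.
pose r := (8 * M)^-1; have r0 : 0 < r by rewrite invr_gt0 mulr_gt0.
have rM : r * (8 * M) = 1 by rewrite mulVf// lt0r_neq0// mulr_gt0.
pose w (z : R) : R := 1 - 2 * x * z + z ^+ 2.
have w0 (z : R) : `|z| < r -> 0 < w z.
  move=> zr; rewrite /w.
  have h : `|2 * x * z| <= 1.
    rewrite !normrM ger0_norm//.
    have : 2 * `|x| <= M by rewrite /M /growth; have := normr_ge0 x; have := l0; nra.
    have := normr_ge0 x; have := normr_ge0 z; move: rM zr M1 r0; nra.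
  have := ler_norm (2 * x * z).
  have [->|z0] := eqVneq z 0; first by rewrite mulr0 expr0n/=; lra.
  have : 0 < z ^+ 2 by rewrite exprn_even_gt0.
  lra.
pose F (z : R) := limn (pseries c z).
pose D (z : R) := limn (pseries (pseries_diffs c) z).
have dF (z : R) : `|z| < r -> is_derive z (1 : R) F (D z).
  move=> zr; apply: (is_derive_pseries M0 cB).
  by move: zr; rewrite -(ltr_pM2r (_ : 0 < 8 * M)) ?rM// mulr_gt0.
have small (z : R) : `|z| < r -> `|z| * (2 * M) < 1.
  by move: (normr_ge0 z) rM M0 r0; nra.
have Cd (z : R) : `|z| < r -> cvgn (pseries (pseries_diffs c) z).
  by move=> zr; apply: cvg_pseries dB _; [lra|exact: small].
have Cc (z : R) : `|z| < r -> cvgn (pseries c z).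
  move=> zr; apply: cvg_pseries (ltW M0) cB _.
  by rewrite (le_lt_trans _ (small _ zr))// ler_wpM2l//; lra.
have dw (z : R) : is_derive z (1 : R) w (2 * z - 2 * x).
  rewrite [w](_ : _ = horner (1 - (2 * x)%:P * 'X + 'X ^+ 2)); last first.
    by apply/funext => y; rewrite /w !hornerE.
  by apply: is_derive_eq; rewrite !poly.derivE !hornerE /=; ring.
pose h (z : R) := F z * w z `^ l.
have dh (z : R) : `|z| < r -> is_derive z (1 : R) h 0.
  move=> zr; have wz := w0 _ zr.
  have dwl : is_derive z (1 : R) (fun z => w z `^ l)
      (l * w z `^ (l - 1) * (2 * z - 2 * x)).
    apply: (@is_derive1_comp _ (fun y => y `^ l) w z _ _ _ (dw z)).
    exact: is_derive1_powR.
  have dFz := dF _ zr.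
  apply: (is_derive_eq (is_deriveM dFz dwl)).
  rewrite /GRing.scale /=.
  have ode := generating_ode (Cc _ zr) (Cd _ zr).
  have -> : w z `^ l = w z * w z `^ (l - 1) by rewrite mulr_powRB1// ltW.
  transitivity (w z `^ (l - 1) * (w z * D z - 2 * l * (x - z) * F z)); first ring.
  by rewrite ode subrr mulr0.
have hcst (a b : R) : a <= b -> `|a| < r -> `|b| < r -> h a = h b.
  rewrite !ltr_norml => ab /andP[ar _] /andP[_ br].
  have inside y : y \in `[a, b] -> `|y| < r.
    rewrite in_itv/= => /andP[ay yb].
    by rewrite ltr_norml (lt_le_trans ar ay) (le_lt_trans yb br).
  have [y /subset_itv_oo_cc/inside/dh//| |y _] := @MVT_segment _ h (cst 0) a b ab.
  - apply/derivable_within_continuous => y /inside yr.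
    by have [] := dh _ yr.
  - by rewrite mul0r => /eqP; rewrite subr_eq0 => /eqP.
have hE (z : R) : `|z| < r -> h z = 1.
  move=> zr; have h0 : h 0 = 1.
    by rewrite /h /F pseries_at0 /w /c hornerC mulr0 subr0 expr0n/= addr0 powR1 mulr1.
  rewrite -[RHS]h0; have [z0|/ltW z0] := leP z 0.
    by apply: hcst; rewrite ?normr0.
  by apply/esym/hcst; rewrite ?normr0.
apply/nbhs_ballP; exists r => //= z; rewrite /ball/= sub0r normrN => zr.
have <- : F z = w z `^ (- l).
  have := hE _ zr; rewrite /h powRN => hz.
  by rewrite -[RHS]mul1r -hz mulfK// lt0r_neq0// powR_gt0// w0.
exact: Cc.
Qed.

(** At each x the two families have the same generating function, hence the
    same values; polynomials equal at all points of R are equal. *)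
Lemma gegenbauerE : gegenbauer l = G.
Proof.
have genC : gegenbauer_generating l (gegenbauer l).
  exact: (xgetPex _ (ex_intro _ _ gegenbauer_generating_rec)).
apply/funext => n; apply/eqP; rewrite -subr_eq0; apply/eqP.
apply: poly_funext0 => x; rewrite hornerD hornerN.
pose c k := (gegenbauer l k).[x] - (G k).[x].
apply: (@pseries_eq0 _ c) => //.
have := gegenbauer_generating_rec x; have := genC x.
apply: filterS2 => z hC hG.
rewrite (_ : pseries c z = series (fun k => (gegenbauer l k).[x] * z ^+ k)
    - series (fun k => (G k).[x] * z ^+ k)); last first.
  apply/funext => k; rewrite /pseries /series /= fctE -sumrB.
  by apply: eq_bigr => i _; rewrite -mulrBl.
by rewrite -(subrr ((1 - 2 * x * z + z ^+ 2) `^ (- l))); exact: cvgB.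
Qed.
End Generating.

(** * Affine changes of variables *)

Section Affine.
Context {R : realType}.
Local Notation mu := (@lebesgue_measure R).

(** Both sides are measures in A, which agree on half-open intervals. *)
Lemma lebesgue_measure_affine (a b : R) (a0 : 0 < a) (A : set R) : measurable A ->
  mu A = (a%:E * mu ((fun x => a * x + b)%R @^-1` A))%E.
Proof.
move=> mA.
pose phi : measurableTypeR R -> measurableTypeR R := fun x => a * x + b.
have mphi : measurable_fun setT phi.
  by apply: measurable_funD => //; exact: measurable_funM.
rewrite [RHS](_ : _ = mscale (NngNum (ltW a0)) (pushforward mu phi) A)//.
apply: lebesgue_measure_unique => // _ [[c d]] _ <-.
rewrite [RHS](_ : _ = (a%:E * mu (phi @^-1` [set` `]c, d]]))%E)//.
rewrite (_ : _ @^-1` _ = [set` `](c - b) / a, (d - b) / a]]); last first.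
  apply/seteqP; split => x /=; rewrite !in_itv/= ltr_pdivrMr// ler_pdivlMr//;
    by rewrite ltrBlDr lerBrDr mulrC.
rewrite !lebesgue_measure_itv/= !lte_fin ltr_pM2r ?invr_gt0// ltrD2r.
case: ifPn => _; last by rewrite mule0.
rewrite -!EFinD -EFinM; congr EFin; field; exact: lt0r_neq0.
Qed.

Lemma ge0_integral_affine (a b : R) (f : R -> \bar R) : 0 < a ->
  measurable_fun [set: R] f -> (forall x, 0 <= f x)%E ->
  (\int[mu]_x f x = a%:E * \int[mu]_x f (a * x + b)%R)%E.
Proof.
move=> a0 mf f0.
pose phi : measurableTypeR R -> measurableTypeR R := fun x => a * x + b.
have mphi : measurable_fun setT phi.
  by apply: measurable_funD => //; exact: measurable_funM.
rewrite (eq_measure_integral (mscale (NngNum (ltW a0)) (pushforward mu phi))).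
  by rewrite ge0_integral_mscale// ge0_integral_pushforward.
by move=> A mA _; exact: lebesgue_measure_affine.
Qed.

End Affine.

(** * Euler's integrals *)

Section EulerIntegrals.
Context {R : realType}.
Local Notation mu := (@lebesgue_measure R).
Implicit Types a b u x : R.

(** Extending the power by 0 to the whole line puts the domains of integration
    into the integrands, so that translations and Tonelli's theorem apply to
    integrals over the line. *)
Definition truncated_power a x : R := if 0 < x then x `^ (a - 1) else 0.
Local Notation pw := truncated_power.

Lemma truncated_power_ge0 a x : 0 <= pw a x.
Proof. by rewrite /pw; case: ifP => // _; exact: powR_ge0. Qed.

Lemma measurable_truncated_power a : measurable_fun [set: R] (pw a).
Proof.
apply: measurable_fun_ifT => //.
exact: measurable_fun_ltr.
Qed.

Lemma truncated_powerM a u x : 0 < u -> pw a (u * x) = u `^ (a - 1) * pw a x.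
Proof.
move=> u0; rewrite /pw pmulr_rgt0//; case: ifPn => x0; last by rewrite mulr0.
by rewrite powRM// ltW.
Qed.

Definition gamma_integral a : \bar R :=
  (\int[mu]_t (pw a t * expR (- t))%:E)%E.

Definition beta_integral a b : \bar R :=
  (\int[mu]_x (pw a x * pw b (1 - x))%:E)%E.

Lemma measurable_gamma_integrand a :
  measurable_fun [set: R] (fun t => pw a t * expR (- t)).
Proof.
apply: measurable_funM; first exact: measurable_truncated_power.
by apply: measurableT_comp => //; exact: measurable_expR.
Qed.

Lemma measurable_truncated_powerM a b u :
  measurable_fun [set: R] (fun x => pw a x * pw b (u - x)).
Proof.
apply: measurable_funM; first exact: measurable_truncated_power.
apply: measurableT_comp; first exact: measurable_truncated_power.
exact: measurable_funB.
Qed.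

(** Scaling by u maps the convolution at u to the one at 1. *)
Lemma convolution_truncated_power a b u :
  (\int[mu]_x (pw a x * pw b (u - x))%:E = (pw (a + b) u)%:E * beta_integral a b)%E.
Proof.
have [u0|u0] := ltP 0 u; last first.
  rewrite [pw (a + b) u]/pw ltNge u0/= mul0e integral0_eq// => x _.
  rewrite /pw; case: ifP => x0; last by rewrite mul0r.
  by rewrite subr_gt0 ltNge (le_trans u0 (ltW x0))/= mulr0.
rewrite [LHS](ge0_integral_affine 0 u0); last 2 first.
- by apply/measurable_EFinP; exact: measurable_truncated_powerM.
- by move=> x; rewrite lee_fin mulr_ge0// truncated_power_ge0.
under eq_integral => x _.
  rewrite addr0 -[X in pw b (X - _)]mulr1 -mulrBr !truncated_powerM//.
  rewrite mulrACA EFinM; over.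
rewrite ge0_integralZl//; last 3 first.
- by apply/measurable_EFinP; exact: measurable_truncated_powerM.
- by move=> x _; rewrite lee_fin mulr_ge0// truncated_power_ge0.
- by rewrite lee_fin mulr_ge0// powR_ge0.
rewrite muleA -EFinM /pw u0; congr (_%:E * _)%E.
rewrite -[X in X * _](powRr1 (ltW u0)) -!powRD ?lt0r_neq0 ?implybT//.
by congr (_ `^ _); ring.
Qed.

Lemma gamma_integral_ge0 a : (0 <= gamma_integral a)%E.
Proof.
by apply: integral_ge0 => x _; rewrite lee_fin mulr_ge0 ?expR_ge0 ?truncated_power_ge0.
Qed.

(** The product is the integral over (s, t) of s^(a-1) t^(b-1) e^-(s + t);
    substituting t = u - s and integrating over s first leaves the convolution
    of the two powers. The identity holds whether the integrals are finite or
    not. *)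
Lemma gamma_beta a b : (gamma_integral a * gamma_integral b =
  gamma_integral (a + b) * beta_integral a b)%E.
Proof.
have mg c := measurable_gamma_integrand c.
have g0 c t : (0 <= (pw c t * expR (- t))%:E)%E.
  by rewrite lee_fin mulr_ge0 ?expR_ge0 ?truncated_power_ge0.
rewrite {1}/gamma_integral -ge0_integralZr//; last 2 first.
- by apply/measurable_EFinP; exact: mg.
- exact: gamma_integral_ge0.
pose f (p : R * R) := pw a p.1 * pw b (p.2 - p.1) * expR (- p.2).
have mf : measurable_fun setT f.
  apply: measurable_funM; first apply: measurable_funM.
  - exact: measurableT_comp (measurable_truncated_power a) measurable_fst.
  - apply: measurableT_comp (measurable_truncated_power b) _.
    exact: measurable_funB measurable_snd measurable_fst.
  - apply: measurableT_comp; first exact: measurable_expR.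
    exact: measurableT_comp.
have f0 p : (0 <= (f p)%:E)%E.
  by rewrite lee_fin !mulr_ge0 ?expR_ge0 ?truncated_power_ge0.
transitivity (\int[mu]_s \int[mu]_u (f (s, u))%:E)%E.
  apply: eq_integral => s _.
  rewrite -ge0_integralZl//; last by apply/measurable_EFinP; exact: mg.
  rewrite [LHS](ge0_integral_affine (- s) ltr01)//; last 2 first.
  - by apply/measurable_EFinP; apply: measurable_funM => //; exact: mg.
  - by move=> x; apply: mule_ge0.
  rewrite mul1e; apply: eq_integral => u _.
  rewrite mul1r /f/= -EFinM; congr EFin.
  rewrite mulrACA -expRD; congr (_ * expR _); ring.
transitivity (\int[mu]_u \int[mu]_s (f (s, u))%:E)%E.
  apply: (@fubini_tonelli _ _ (measurableTypeR R) (measurableTypeR R) R mu mu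
    (fun p => (f p)%:E)) => //.
  exact/measurable_EFinP.
rewrite /gamma_integral -[RHS]ge0_integralZr//; last 2 first.
- by apply/measurable_EFinP; exact: mg.
- by apply: integral_ge0 => x _; rewrite lee_fin mulr_ge0// truncated_power_ge0.
apply: eq_integral => u _.
under eq_integral => s _ do rewrite /f/= mulrC EFinM.
rewrite [LHS]ge0_integralZl; last 4 first.
- exact: measurableT.
- by apply/measurable_EFinP; exact: measurable_truncated_powerM.
- by move=> x _; rewrite lee_fin mulr_ge0// truncated_power_ge0.
- by rewrite lee_fin expR_ge0.
by rewrite convolution_truncated_power muleA -EFinM [_ * expR _]mulrC.
Qed.
End EulerIntegrals.

Section GammaValues.
Context {R : realType}.
Local Notation mu := (@lebesgue_measure R).
Local Notation pw := truncated_power.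
Implicit Types a b u x : R.

Lemma integral_powR_itv a (e : R) : 0 < a -> 0 < e < 1 ->
  (\int[mu]_(x in `[e, 1%R]) (x `^ (a - 1))%:E = (a^-1 * (1 - e `^ a))%:E)%E.
Proof.
move=> a0 /andP[e0 e1].
have dF x : 0 < x -> is_derive x (1 : R) (fun y => a^-1 * y `^ a) (x `^ (a - 1)).
  move=> x0; have h := is_derive1_powR a x0.
  have -> : x `^ (a - 1) = a^-1 * (a * x `^ (a - 1)).
    by rewrite mulrA mulVf ?mul1r// lt0r_neq0.
  exact: is_deriveZ.
have cont b x : 0 < x -> {for x, continuous (fun y : R => y `^ b)}.
  by move=> x0; apply/differentiable_continuous/derivable1_diffP/derivable_powR;
    rewrite in_itv/= x0.
rewrite (@continuous_FTC2 _ _ (fun y => a^-1 * y `^ a))//.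
- by rewrite powR1 -EFinB mulrBr.
- apply: continuous_in_subspaceT => x; rewrite inE/= in_itv/= => /andP[ex _].
  by apply: cont; exact: lt_le_trans ex.
- have contF x : 0 < x -> {for x, continuous (fun y : R => a^-1 * y `^ a)}.
    by move=> x0; apply: cvgMl_tmp; exact: cont.
  split.
  + move=> x; rewrite in_itv/= => /andP[ex _].
    by have [] := dF _ (lt_trans e0 ex).
  + by apply: cvg_at_right_filter; exact: contF.
  + by apply: cvg_at_left_filter; exact: contF.
- move=> x; rewrite in_itv/= => /andP[ex _].
  by rewrite derive1E; have [_ ->] := dF _ (lt_trans e0 ex).
Qed.

(** For a < 1 the integrand is unbounded at 0: the fundamental theorem of
    calculus is applied on [e, 1] and e tends to 0. *)
Lemma beta_integral1 a : 0 < a -> beta_integral a 1 = (a^-1)%:E.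
Proof.
move=> a0.
pose f x : R := x `^ (a - 1).
have mf (D : set R) : measurable_fun D (EFin \o f).
  by apply/measurable_EFinP; apply: measurable_funTS; exact: measurable_powR.
have f0 x : (0 <= (f x)%:E)%E by rewrite lee_fin powR_ge0.
have -> : beta_integral a 1 = (\int[mu]_(x in `]0%R, 1%R[) (f x)%:E)%E.
  rewrite integral_mkcond; apply: eq_integral => x _.
  rewrite patchE /truncated_power subr_gt0.
  have -> : (x \in `]0, 1[%classic) = (0 < x) && (x < 1).
    by apply/idP/idP => [/set_mem|x01]; [|apply/mem_set]; rewrite /= in_itv.
  case: (0 < x) => /=; last by rewrite mul0r.
  by case: (x < 1); rewrite ?mulr0// subrr powRr0 mulr1.
rewrite integral_itv_bndo_bndc//.
pose F n : set R := [set` `[n.+2%:R^-1, 1]].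
have FE : \bigcup_n F n = [set` `]0, 1]].
  apply/seteqP; split => x /=.
    move=> [n _]; rewrite /F/= !in_itv/= => /andP[nx ->]; rewrite andbT.
    by rewrite (lt_le_trans _ nx)// invr_gt0.
  rewrite in_itv/= => /andP[x0 x1].
  have := archi_boundP (ltW (_ : 0 < x^-1)); rewrite invr_gt0 => /(_ x0) h.
  exists (Num.bound x^-1) => //; rewrite /F/= in_itv/= x1 andbT.
  rewrite -[leRHS]invrK lef_pV2 ?posrE ?invr_gt0//.
  by rewrite (le_trans (ltW h))// ler_nat -addn2 leq_addr.
have h : (\int[mu]_(x in F i) (f x)%:E)%E @[i --> \oo] -->
    (\int[mu]_(x in \bigcup_i F i) (f x)%:E)%E.
  apply: ge0_nondecreasing_set_cvg_integral => //.
  - move=> i j ij; apply/subsetPset => x; rewrite /F/= !in_itv/= => /andP[ix ->].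
    by rewrite andbT (le_trans _ ix)// lef_pV2 ?posrE// ler_nat !ltnS.
  - by move=> i; exact: measurable_itv.
  - by move=> i; apply/measurable_EFinP; apply: measurable_funTS; exact: measurable_powR.
rewrite FE in h.
have h' : (\int[mu]_(x in F i) (f x)%:E)%E @[i --> \oo] --> (a^-1)%:E.
  rewrite (_ : (fun i => _) = fun i => (a^-1 * (1 - (i.+2%:R^-1) `^ a))%:E); last first.
    apply/funext => i; apply: integral_powR_itv => //.
    by rewrite invr_gt0 ltr0n/= invf_lt1// ltr1n.
  apply: cvg_EFin; first exact: nearW.
  have p0 : (i.+2%:R^-1 : R) `^ a @[i --> \oo] --> (0 : R).
    have /cvg_at_rightP := @powR_cvg0 R a a0; apply; split=> //.
    have := @cvg_harmonic R; rewrite -cvg_shiftS; exact.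
  have : a^-1 * (1 - (i.+2%:R^-1 : R) `^ a) @[i --> \oo] --> a^-1 * (1 - 0).
    by apply: cvgMl_tmp; apply: cvgB => //; exact: cvg_cst.
  by rewrite subr0 mulr1.
by move: h h' => /cvg_lim <- // /cvg_lim <-.
Qed.
End GammaValues.

(** * The Gamma function *)

Section GammaFunction.
Context {R : realType}.
Local Notation mu := (@lebesgue_measure R).
Local Notation pw := truncated_power.
Implicit Types a b u x : R.

Lemma gamma_integral_itv a : gamma_integral a =
  (\int[mu]_(t in `]0%R, +oo[) (t `^ (a - 1) * expR (- t))%:E)%E.
Proof.
rewrite [RHS]integral_mkcond; apply: eq_integral => t _.
rewrite patchE /truncated_power.
have -> : (t \in `]0, +oo[%classic) = (0 < t).
  by apply/idP/idP => [/set_mem|t0]; [|apply/mem_set]; rewrite /= in_itv/= andbT.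
by case: (0 < t); rewrite ?mul0r.
Qed.

Lemma GammaE a : Gamma a = fine (gamma_integral a).
Proof. by rewrite gamma_integral_itv. Qed.

Lemma gamma_integral1 : gamma_integral (1 : R) = 1%E.
Proof.
rewrite gamma_integral_itv subrr.
rewrite integral_itv_obnd_cbnd; last first.
  apply/measurable_EFinP; apply: measurable_funM; apply: measurable_funTS.
    exact: measurable_powR.
  by apply: measurableT_comp => //; exact: measurable_expR.
rewrite -(integral_exponential_pdf (ltr01 : 0 < (1 : R))).
rewrite integral_mkcond; apply: eq_integral => t _.
rewrite /exponential_pdf !patchE; case: ifPn => // _.
by rewrite powRr0 !mul1r mulN1r.
Qed.

(** This is [gamma_beta] for b = 1, where both other factors are known. *)
Lemma gamma_integralS a : 0 < a ->
  gamma_integral (a + 1) = (a%:E * gamma_integral a)%E.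
Proof.
move=> a0; have := gamma_beta a 1; rewrite gamma_integral1 mule1 beta_integral1// => ->.
by rewrite muleCA -EFinM mulfV ?mule1// lt0r_neq0.
Qed.

Lemma gamma_integral_nat_fin n : gamma_integral (n.+1%:R : R) \is a fin_num.
Proof.
elim: n => [|n IH]; first by rewrite gamma_integral1.
by rewrite -natr1 gamma_integralS// fin_numM.
Qed.

(** By [gamma_integralS] one may suppose 1 <= a, and then
    t^(a-1) <= 1 + t^n for n >= a - 1. *)
Lemma gamma_integral_fin a : 0 < a -> gamma_integral a \is a fin_num.
Proof.
suff h b : 1 <= b -> gamma_integral b \is a fin_num.
  move=> a0; have : gamma_integral (a + 1) \is a fin_num by apply: h; rewrite lerDr ltW.
  rewrite gamma_integralS//; move: (gamma_integral_ge0 a).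
  by case: (gamma_integral a) => //= _; rewrite gt0_muley.
move=> b1; have b0 : 0 <= b by lra.
set n := Num.bound b.
have bn : b <= n.+1%:R.
  by rewrite (le_trans (ltW (archi_boundP b0)))// ler_nat.
rewrite ge0_fin_numE ?gamma_integral_ge0//.
apply: (@le_lt_trans _ _ (gamma_integral 1 + gamma_integral n.+1%:R)%E); last first.
  rewrite gamma_integral1 lte_add_pinfty ?ltry// ltey_eq.
  by rewrite gamma_integral_nat_fin.
have mg c := measurable_gamma_integrand c.
have g0 c t : 0 <= pw c t * expR (- t).
  by rewrite mulr_ge0 ?expR_ge0 ?truncated_power_ge0.
rewrite /gamma_integral -ge0_integralD//.
- apply: ge0_le_integral => //.
  + by move=> x _; rewrite lee_fin; exact: g0.
  + by apply/measurable_EFinP; exact: mg.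
  + by apply: emeasurable_funD; apply/measurable_EFinP; exact: mg.
  + move=> x _; rewrite -EFinD lee_fin -mulrDl ler_wpM2r ?expR_ge0//.
    rewrite /truncated_power; case: ifPn => x0; last by rewrite addr0.
    rewrite subrr powRr0; have [x1|/ltW x1] := leP 1 x.
      by rewrite ler_wpDl// ler_powR// lerB.
    rewrite ler_wpDr ?powR_ge0//.
    have := @ger_powR R x; rewrite x0 x1 => /(_ isT 0 (b - 1)).
    by rewrite powRr0; apply; rewrite subr_ge0.
- by move=> x _; rewrite lee_fin; exact: g0.
- by apply/measurable_EFinP; exact: mg.
- by move=> x _; rewrite lee_fin; exact: g0.
- by apply/measurable_EFinP; exact: mg.
Qed.

(** By [gamma_integralS] one may suppose 1 <= a; the integrand is then at least
    e^-2 on [1, 2]. *)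
Lemma gamma_integral_gt0 a : 0 < a -> (0 < gamma_integral a)%E.
Proof.
suff h b : 1 <= b -> (0 < gamma_integral b)%E.
  move=> a0; have : (0 < gamma_integral (a + 1))%E by apply: h; rewrite lerDr ltW.
  by rewrite gamma_integralS// pmule_rgt0.
move=> b1.
have mg := measurable_gamma_integrand b.
apply: (@lt_le_trans _ _ (\int[mu]_(x in `[1%R, 2%R]) (expR (- 2))%:E)%E).
  rewrite integral_cst//= lebesgue_measure_itv/= lte_fin ltr1n/=.
  by rewrite mule_gt0// lte_fin ?expR_gt0//; lra.
apply: (@le_trans _ _ (\int[mu]_(x in `[1%R, 2%R]) (pw b x * expR (- x))%:E)%E).
  apply: ge0_le_integral => //.
  - by apply/measurable_EFinP; apply: measurable_funTS; exact: mg.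
  - move=> x; rewrite /= in_itv/= => /andP[x1 x2].
    rewrite lee_fin -[leLHS]mul1r ler_pM ?expR_ge0// ?ler_expR ?lerN2//.
    rewrite /truncated_power (lt_le_trans _ x1)//.
    by rewrite -[leLHS](powRr0 x) ler_powR// subr_ge0.
apply: ge0_subset_integral => //.
- by apply/measurable_EFinP; exact: mg.
- by move=> x _; rewrite lee_fin mulr_ge0 ?expR_ge0 ?truncated_power_ge0.
Qed.

Lemma Gamma_gt0 a : 0 < a -> 0 < Gamma a.
Proof.
by move=> a0; rewrite GammaE fine_gt0// gamma_integral_gt0//= -ge0_fin_numE
  ?gamma_integral_ge0// gamma_integral_fin.
Qed.

Lemma GammaS a : 0 < a -> Gamma (a + 1) = a * Gamma a.
Proof.
by move=> a0; rewrite !GammaE gamma_integralS// fineM// gamma_integral_fin.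
Qed.

Lemma Gamma_pochhammer a k : 0 < a -> Gamma (a + k%:R) = pochhammer a k * Gamma a.
Proof.
move=> a0; elim: k => [|k IH]; first by rewrite addr0 /pochhammer big_ord0 mul1r.
rewrite -(natr1 k) addrA GammaS; last by rewrite ltr_wpDr.
by rewrite IH pochhammerS mulrA [pochhammer a k * _]mulrC.
Qed.

Lemma beta_integralE a b : 0 < a -> 0 < b ->
  beta_integral a b = (Gamma a * Gamma b / Gamma (a + b))%:E.
Proof.
move=> a0 b0; have ab0 : 0 < a + b by exact: addr_gt0.
have := gamma_beta a b.
rewrite -[gamma_integral a]fineK ?gamma_integral_fin// -GammaE.
rewrite -[gamma_integral b]fineK ?gamma_integral_fin// -GammaE.
rewrite -[gamma_integral (a + b)]fineK ?gamma_integral_fin// -GammaE.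
have := Gamma_gt0 ab0; move: (Gamma (a + b)) => c c0.
rewrite mulrC !EFinM => ->.
by rewrite muleA -EFinM mulVf ?mul1e// lt0r_neq0.
Qed.
End GammaFunction.

(** * Integration against the weight *)

Section Moments.
Context {R : realType}.
Local Notation mu := (@lebesgue_measure R).
Local Notation pw := truncated_power.
Implicit Types a b : R.

(** The substitution x = 2 y - 1 maps this to a Beta integral. *)
Lemma jacobi_moment a b : 0 < a -> 0 < b ->
  (\int[mu]_(x in `](-1)%R, 1%R[) ((1 - x) `^ (a - 1) * (1 + x) `^ (b - 1))%:E =
  (2 `^ (a + b - 1) * (Gamma a * Gamma b / Gamma (a + b)))%:E)%E.
Proof.
move=> a0 b0.
transitivity (\int[mu]_x (pw a (1 - x) * pw b (1 + x))%:E)%E.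
  rewrite integral_mkcond; apply: eq_integral => x _.
  rewrite patchE /truncated_power.
  have -> : (x \in `](-1), 1[%classic) = (0 < 1 - x) && (0 < 1 + x).
    rewrite subr_gt0 andbC -ltrBlDl sub0r.
    by apply/idP/idP => [/set_mem|h]; [|apply/mem_set]; rewrite /= in_itv.
  case: (0 < 1 - x) => /=; last by rewrite mul0r.
  by case: (0 < 1 + x); rewrite ?mulr0.
rewrite (ge0_integral_affine (-1) (ltr0Sn R 1)); last 2 first.
- apply/measurable_EFinP; apply: measurable_funM.
    apply: measurableT_comp; first exact: measurable_truncated_power.
    exact: measurable_funB.
  apply: measurableT_comp; first exact: measurable_truncated_power.
  exact: measurable_funD.
- by move=> x; rewrite lee_fin mulr_ge0// truncated_power_ge0.
under eq_integral => x _.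
  have -> : 1 - (2 * x + -1) = 2 * (1 - x) by ring.
  have -> : 1 + (2 * x + -1) = 2 * x by ring.
  rewrite !truncated_powerM// mulrACA [pw a _ * _]mulrC EFinM; over.
rewrite ge0_integralZl//; last 2 first.
- by apply/measurable_EFinP; exact: measurable_truncated_powerM.
- by move=> x _; rewrite lee_fin mulr_ge0// truncated_power_ge0.
rewrite -/(beta_integral b a) beta_integralE// muleA -!EFinM; congr EFin.
rewrite [Gamma b * _]mulrC [b + a]addrC; congr (_ * _).
rewrite -powRD ?pnatr_eq0 ?implybT// -[X in X * _](powRr1 (ler0n _ 2)).
by rewrite -powRD ?pnatr_eq0 ?implybT//; congr (_ `^ _); ring.
Qed.

Lemma pochhammer_double a k : pochhammer a k.*2 =
  4 ^+ k * pochhammer (a / 2) k * pochhammer ((a + 1) / 2) k.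
Proof.
elim: k => [|k IH]; first by rewrite /pochhammer !big_ord0 expr0 !mulr1.
by rewrite doubleS !pochhammerS IH exprS -muln2 -[(k * 2).+1%:R]natr1 natrM; field.
Qed.

(** The shifts by k turn Gamma values into Pochhammer symbols; the factor 4^k of
    the power of 2 cancels the one of [pochhammer_double]. *)
Lemma jacobi_moment_shift a b k : 0 < a -> 0 < b ->
  (\int[mu]_(x in `](-1)%R, 1%R[)
    ((1 - x) `^ (a + k%:R - 1) * (1 + x) `^ (b + k%:R - 1))%:E =
  (2 `^ (a + b - 1) * (Gamma a * Gamma b / Gamma (a + b))
   * (pochhammer a k * pochhammer b k
      / (pochhammer ((a + b) / 2) k * pochhammer ((a + b + 1) / 2) k)))%:E)%E.
Proof.
move=> a0 b0; rewrite jacobi_moment ?ltr_wpDr//; congr EFin.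
have ab0 : 0 < a + b by exact: addr_gt0.
have -> : a + k%:R + (b + k%:R) = a + b + k.*2%:R.
  by rewrite -muln2 natrM; ring.
have -> : 2 `^ (a + b + k.*2%:R - 1) = 2 `^ (a + b - 1) * 4 ^+ k :> R.
  have -> : 4 ^+ k = 2 `^ k.*2%:R :> R.
    by rewrite powR_mulrn// -muln2 mulnC exprM; congr (_ ^+ _); ring.
  by rewrite -powRD ?pnatr_eq0 ?implybT//; congr (_ `^ _); ring.
rewrite !Gamma_pochhammer// pochhammer_double.
have G0 := lt0r_neq0 (Gamma_gt0 ab0).
have p1 : pochhammer ((a + b) / 2) k != 0.
  by rewrite lt0r_neq0// pochhammer_gt0//; lra.
have p2 : pochhammer ((a + b + 1) / 2) k != 0.
  by rewrite lt0r_neq0// pochhammer_gt0//; lra.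
have : 4 ^+ k != 0 :> R by rewrite expf_neq0// pnatr_eq0.
move: (4 ^+ k) (Gamma a) (Gamma b) (Gamma (a + b)) G0 => f Ga Gb Gab G0 f0.
field.
by rewrite G0 p1 p2 f0.
Qed.

Lemma measurable_jacobi_weight (p q : R) :
  measurable_fun [set: R] (fun x => (1 - x) `^ p * (1 + x) `^ q).
Proof.
apply: measurable_funM; apply: (measurableT_comp (measurable_powR _)).
  exact: measurable_funB.
exact: measurable_funD.
Qed.

Lemma hypergeometric_terminating (n : nat) (s t : seq R) (z : R) :
  hypergeometric (- n%:R :: s) t z = \sum_(k < n.+1)
    (\prod_(c <- - n%:R :: s) pochhammer c k) /
    ((\prod_(d <- t) pochhammer d k) * (k`!)%:R) * z ^+ k.
Proof.
rewrite /hypergeometric; set u := fun k => _.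
have u0 k : (n < k)%N -> u k = 0.
  by move=> nk; rewrite /u big_cons pochhammer_opp_nat// !mul0r.
apply: lim_near_cst => //; exists n.+1 => // m /= nm.
rewrite /series/= (big_cat_nat _ nm)//= big_mkord.
rewrite [X in _ + X]big_nat_cond [X in _ + X]big1 ?addr0// => k.
by rewrite andbT => /andP[nk _]; exact: u0.
Qed.
End Moments.

Theorem theorem1 (R : realType) (lambda alpha beta : R) (n : nat)
    (hlambda : 0 < lambda) (halpha : -1 < alpha) (hbeta : -1 < beta) :
  (\int[@lebesgue_measure R]_(x in `[(-1)%R, 1%R])
     ((gegenbauer lambda n).[x] ^+ 2 * (1 - x) `^ alpha * (1 + x) `^ beta)%:E)%E
  = (2 `^ (alpha + beta + 1)
     * (Gamma (alpha + 1) * Gamma (beta + 1) / Gamma (alpha + beta + 2))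
     * (pochhammer (2 * lambda) n / (n`!)%:R) ^+ 2
     * hypergeometric
         [:: - n%:R; n%:R + 2 * lambda; lambda; alpha + 1; beta + 1]
         [:: 2 * lambda; lambda + 1 / 2; (alpha + beta + 2) / 2;
             (alpha + beta + 3) / 2]
         1)%:E.
Proof.
pose f (x : R) :=
  (gegenbauer lambda n).[x] ^+ 2 * (1 - x) `^ alpha * (1 + x) `^ beta.
have mf (D : set R) : measurable_fun D (EFin \o f).
  apply/measurable_EFinP; apply: measurable_funTS.
  rewrite /f; under eq_fun do rewrite -mulrA.
  apply: measurable_funM; last exact: measurable_jacobi_weight.
  apply: measurable_funX.
  by apply: continuous_measurable_fun; exact: continuous_horner.
(* the laws of powers used in the expansion need 1 - x and 1 + x positive *)
rewrite -[LHS]integral_itv_bndo_bndc; last exact: mf.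
rewrite -[LHS]integral_itv_obnd_cbnd; last exact: mf.
set P := (pochhammer (2 * lambda) n / n`!%:R) ^+ 2.
pose w k (x : R) :=
  (1 - x) `^ (alpha + 1 + k%:R - 1) * (1 + x) `^ (beta + 1 + k%:R - 1).
have fE x : x \in `](-1), 1[ ->
    f x = \sum_(k < n.+1) P * clausen_coef lambda n k * w k x.
  rewrite in_itv/= => /andP[x1 x2].
  have p1 : 0 < 1 - x by lra.
  have p2 : 0 < 1 + x by lra.
  have powE p (y : R) k : 0 < y -> y `^ (p + 1 + k%:R - 1) = y ^+ k * y `^ p.
    move=> y0; rewrite -powR_mulrn ?ltW// -powRD ?lt0r_neq0 ?implybT//.
    by congr (_ `^ _); ring.
  have := congr1 (fun p : {poly R} => p.[x]) (gegenbauer_rec_sqr n hlambda).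
  rewrite /f gegenbauerE// horner_exp horner_sum => ->.
  rewrite -mulrA mulr_suml; apply: eq_bigr => k _.
  rewrite hornerZ horner_exp -/P /w !powE//.
  have -> : (1 - 'X ^+ 2 : {poly R}).[x] = (1 - x) * (1 + x).
    by rewrite !hornerE; ring.
  by rewrite exprMn; ring.
have w0 k x : 0 <= w k x by rewrite mulr_ge0// powR_ge0.
have a1 : 0 < alpha + 1 by lra.
have b1 : 0 < beta + 1 by lra.
have wM k := jacobi_moment_shift k a1 b1.
(* the coefficients change sign, so integrability is needed to integrate termwise *)
have iw k : (@lebesgue_measure R).-integrable `](-1), 1[ (EFin \o w k).
  apply/integrableP; split.
    apply/measurable_EFinP; apply: measurable_funTS.
    exact: measurable_jacobi_weight.
  under eq_integral => x _ do rewrite /= ger0_norm//.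
  by rewrite wM ltry.
transitivity (\int[@lebesgue_measure R]_(x in `](-1)%R, 1%R[)
    \sum_(k < n.+1) ((P * clausen_coef lambda n k)%:E * (w k x)%:E))%E.
  apply: eq_integral => x /set_mem xI.
  rewrite -[X in X%:E]/(f x) (fE x xI) -sumEFin; apply: eq_bigr => k _.
  by rewrite EFinM.
rewrite integral_sum//; last first.
  by move=> k; apply: integrableZl => //; exact: iw.
under eq_bigr => k _.
  rewrite integralZl//; last exact: iw.
  rewrite wM -EFinM; over.
rewrite sumEFin; congr EFin.
rewrite hypergeometric_terminating mulr_sumr; apply: eq_bigr => k _.
rewrite !big_cons !big_nil expr1n !mulr1 /clausen_coef.
have -> : alpha + 1 + (beta + 1) = alpha + beta + 2 by ring.
have -> : alpha + beta + 2 - 1 = alpha + beta + 1 by ring.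
have -> : alpha + beta + 2 + 1 = alpha + beta + 3 by ring.
by rewrite !invfM; ring.
Qed.
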